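(* Let $p,q,r,a,b,c$ be even positive integers and let $\tau$ be a transposition in the symmetric group on three letters, so that $(\tau(a),\tau(b),\tau(c))$ is one of $(b,a,c)$, $(a,c,b)$, $(c,b,a)$. Then $$\nabla_{K\left(\begin{smallmatrix} p & q & r\\ a & b & c\end{smallmatrix}\right)}=\nabla_{K\left(\begin{smallmatrix} p & q & r\\ \tau(a) & \tau(b) & \tau(c)\end{smallmatrix}\right)}$$ if and only if $$K\left(\begin{smallmatrix} p & q & r\\ a & b & c\end{smallmatrix}\right)=K\left(\begin{smallmatrix} p & q & r\\ \tau(a) & \tau(b) & \tau(c)\end{smallmatrix}\right)$$ by a $D_3$ symmetry.
   Context: Twist regions. Let $e$ be an arc (an edge) in $S^2$ with two disjoint strands running parallel to $e$, one on each side. To put the integer label $n$ on $e$ means to twist these two strands about $e$ by $|n|$ half twists, producing a row of $|n|$ crossings along $e$ (none if $n=0$), all of sign $\operatorname{sign}(n)$ relative to $e$. A crossing is positive relative to $e$ if, when the picture (with $S^2$ viewed from a fixed side) is rotated locally so that $e$ is vertical, the overcrossing strand runs from upper left to lower right; it is negative if the overcrossing strand runs from lower left to upper right. The diagram $K\left(\begin{smallmatrix} p & q & r\\ a & b & c\end{smallmatrix}\right)$, for integers $p,q,r,a,b,c$. Divide a circle $C\subset S^2$ into six arcs $A_1,B_1,A_2,B_2,A_3,B_3$ in this cyclic order. In one complementary disk of $C$ (the inside) take a Y-shaped tree $T$ with one trivalent vertex and three legs ending at interior points of $A_1,A_2,A_3$, and three disjoint strands forming the boundary of a thin neighborhood of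 $T$, the $i$-th strand joining the two endpoints of $B_i$; two strands run along each leg. Put labels $p,q,r$ on the legs ending at $A_1,A_2,A_3$, respectively. In the other disk (the outside) take a Y-shaped tree $T'$ with legs ending at interior points of $B_1,B_2,B_3$ and three strands forming the boundary of a thin neighborhood of $T'$, the $i$-th strand joining the two endpoints of $A_i$; put labels $a,b,c$ on the legs ending at $B_1,B_2,B_3$, respectively. The union is the link diagram $K\left(\begin{smallmatrix} p & q & r\\ a & b & c\end{smallmatrix}\right)$. When all six labels are even it presents a knot. Equality of knots means ambient isotopy in $S^3$. $D_3$ symmetry. Two such knots are equal by a $D_3$ symmetry if their label arrays are interchangeable by repeated use of the following relations, realized by isotopies: the rotations $K\left(\begin{smallmatrix} p & q & r\\ a & b & c\end{smallmatrix}\right)=K\left(\begin{smallmatrix} q & r & p\\ b & c & a\end{smallmatrix}\right)=K\left(\begin{smallmatrix} r & p & q\\ c & a & b\end{smallmatrix}\right)$ and the reflection $K\left(\begin{smallmatrix} p & q & r\\ a & b & c\end{smallmatrix}\right)=K\left(\begin{smallmatrix} p & r & q\\ c & b & a\end{smallmatrix}\right)$. $\nabla_K(z)$ is the Conway polynomial, with $\nabla=1$ for the unknot and $\nabla_{L_+}-\nabla_{L_-}=z\nabla_{L_0}$. *)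

(* Defs.v *)
From Stdlib Require Import Relation_Operators.
From mathcomp Require Import all_boot all_order all_algebra.
Set Implicit Arguments.
Unset Strict Implicit.
Unset Printing Implicit Defensive.

Import GRing.Theory Num.Theory.
Local Open Scope ring_scope.

(** A link diagram is put in Morse position, cut by horizontal lines into slices
  and read from bottom to top.  A slice [(g, i)] is one elementary piece [g]
  with [i] vertical strands to its left (and any number to its right):
  - [Cup o], a local minimum, adds two strands at positions [i] and [i.+1];
  - [Cap], a local maximum, joins the strands at positions [i] and [i.+1];
  - [Cross s] exchanges the strands at positions [i] and [i.+1]; the
    overcrossing strand runs from upper left to lower right if [s = true], and
    from lower left to upper right if [s = false].
  The type [O] holds what is recorded at a minimum: [unit] for unoriented
  diagrams; [bool] for oriented ones, where [Cup d] has its left strand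
  oriented upwards if [d = true] and downwards if [d = false].  As every
  component has a minimum, this determines the orientation. *)
Inductive piece (O : Type) : Type :=
  | Cup of O
  | Cap
  | Cross of bool.
Arguments Cap {O}.
Arguments Cross {O} s : rename.

Definition slice (O : Type) : Type := (piece O * nat)%type.
Definition diagram : Type := seq (slice unit).
Definition odiagram : Type := seq (slice bool).

Definition strands_below (O : Type) (g : piece O) : nat :=
  if g is Cup _ then 0%N else 2%N.
Definition strands_above (O : Type) (g : piece O) : nat :=
  if g is Cap then 0%N else 2%N.

Definition erase_slice (x : slice bool) : slice unit :=
  (match x.1 with Cup _ => Cup tt | Cap => Cap | Cross s => Cross s end, x.2).

Definition erase (D : odiagram) : diagram := map erase_slice D.

(** The strands met by a horizontal line are listed from left to right, with
  [true] for an upward strand.  [up s x] is the list just above the slice [x]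
  when it is [s] just below, and is [None] if [x] does not fit on [s] (too few
  strands, or inconsistent orientations at a maximum). *)
Definition up (s : seq bool) (x : slice bool) : option (seq bool) :=
  let: (g, i) := x in
  match g with
  | Cup d => if (i <= size s)%N then Some (take i s ++ [:: d, ~~ d & drop i s])
             else None
  | Cap => if drop i s is [:: u, v & t] then
             if u != v then Some (take i s ++ t) else None
           else None
  | Cross _ => if drop i s is [:: u, v & t] then Some (take i s ++ [:: v, u & t])
               else None
  end.

Definition run (s : seq bool) (D : odiagram) : option (seq bool) :=
  foldl (fun o x => obind (up^~ x) o) (Some s) D.

Definition link_diagram (D : odiagram) : bool := run [::] D == Some [::].

Definition orientation_of (K : diagram) (D : odiagram) : Prop :=
  link_diagram D /\ erase D = K.

(** The first five moves generate the planar isotopies between diagrams in Morse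
  position.  The Reidemeister moves with other orientations or crossings follow
  from the versions given here.  Orientations of new minima are forced, through
  [link_diagram] in [move] below, by those of the strands they are joined to. *)
Inductive local_move : odiagram -> odiagram -> Prop :=
  | Exchange g h i j :
      local_move [:: (g, i); (h, i + strands_above g + j)%N]
                 [:: (h, i + strands_below g + j)%N; (g, i)]
  | ZigzagL d i : local_move [:: (Cup d, i.+1); (Cap, i)] [::]
  | ZigzagR d i : local_move [:: (Cup d, i); (Cap, i.+1)] [::]
  | SlideCup d s i :
      local_move [:: (Cup d, i); (Cross s, i.+1)]
                 [:: (Cup d, i.+1); (Cross (~~ s), i)]
  | SlideCap s i :
      local_move [:: (Cross s, i.+1); (Cap, i)]
                 [:: (Cross (~~ s), i); (Cap, i.+1)]
  | Reidemeister1Cup d s i :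
      local_move [:: (Cup d, i); (Cross s, i)] [:: (Cup (~~ d), i)]
  | Reidemeister1Cap s i :
      local_move [:: (Cross s, i); (Cap, i)] [:: (Cap, i)]
  | Reidemeister2 s i :
      local_move [:: (Cross s, i); (Cross (~~ s), i)] [::]
  | Reidemeister3 s i :
      local_move [:: (Cross s, i); (Cross s, i.+1); (Cross s, i)]
                 [:: (Cross s, i.+1); (Cross s, i); (Cross s, i.+1)].

Inductive move : odiagram -> odiagram -> Prop :=
  | Move (D1 E E' D2 : odiagram) :
      local_move E E' ->
      link_diagram (D1 ++ E ++ D2) -> link_diagram (D1 ++ E' ++ D2) ->
      move (D1 ++ E ++ D2) (D1 ++ E' ++ D2).

Definition isotopic : odiagram -> odiagram -> Prop :=
  clos_refl_sym_trans odiagram move.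

(** [u] and [v] are the orientations of the strands below a crossing, from left
  to right.  When both are upward, the positive (right-handed) crossing is the
  one whose overcrossing strand runs from lower left to upper right; reversing
  one of the two strands exchanges positive and negative. *)
Definition positive_crossing (u v : bool) : piece bool := Cross (u != v).
Definition negative_crossing (u v : bool) : piece bool := Cross (u == v).

(** For antiparallel strands the smoothing that respects the orientations is a
  maximum below a minimum. *)
Definition smoothing (u v : bool) (i : nat) : odiagram :=
  if u == v then [::] else [:: (Cap, i); (Cup v, i)].

(** The variable ['X] is Conway's [z]. *)
Record is_conway_polynomial (nabla : odiagram -> {poly int}) : Prop := {
  conway_isotopy : forall D D', isotopic D D' -> nabla D = nabla D';
  conway_unknot : forall d, nabla [:: (Cup d, 0%N); (Cap, 0%N)] = 1;
  conway_skein : forall (D1 D2 : odiagram) (s t : seq bool) (u v : bool),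
    let i := size s in
    let Lplus := D1 ++ (positive_crossing u v, i) :: D2 in
    let Lminus := D1 ++ (negative_crossing u v, i) :: D2 in
    let Lzero := D1 ++ smoothing u v i ++ D2 in
    run [::] D1 = Some (s ++ [:: u, v & t]) ->
    link_diagram Lplus -> link_diagram Lminus -> link_diagram Lzero ->
    nabla Lplus - nabla Lminus = 'X * nabla Lzero
}.

Definition labels : Type := ((int * int * int) * (int * int * int))%type.

(** [`|n|] half twists about a vertical arc [e], with [i] strands to the left
  of the twisted pair. *)
Definition twist (i : nat) (n : int) : diagram :=
  nseq `|n|%N (Cross (0 <= n), i).

(** The circle C is drawn as a horizontal line closed up by a point at infinity
  lying in B_3, with its inside below it.  It meets the diagram in six points
  x_1, ..., x_6 from left to right, with A_i = [x_(2i-1), x_(2i)],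
  B_i = [x_(2i), x_(2i+1)] for i < 3, and B_3 running from x_6 to x_1 through
  infinity.  Below C, the three minima are the strands joining the endpoints of
  B_3, B_1, B_2.  Above C, the cap at position 2 joins x_3 to x_4; the leg of
  T' ending in B_3 then leaves upwards between the strands starting at x_2 and
  x_5, which twist about it [c] times and come back down to x_1 and x_6. *)
Definition K (l : labels) : diagram :=
  let: ((p, q, r), (a, b, c)) := l in
  [:: (Cup tt, 0%N); (Cup tt, 1%N); (Cup tt, 3%N)]
  ++ twist 0 p ++ twist 2 q ++ twist 4 r
  ++ twist 1 a ++ twist 3 b
  ++ [:: (Cap, 2%N)]
  ++ twist 1 c
  ++ [:: (Cap, 0%N); (Cap, 0%N)].

Inductive D3_relation : labels -> labels -> Prop :=
  | Rotation1 p q r a b c :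
      D3_relation ((p, q, r), (a, b, c)) ((q, r, p), (b, c, a))
  | Rotation2 p q r a b c :
      D3_relation ((p, q, r), (a, b, c)) ((r, p, q), (c, a, b))
  | Reflection p q r a b c :
      D3_relation ((p, q, r), (a, b, c)) ((p, r, q), (c, b, a)).

Definition D3_symmetric : labels -> labels -> Prop :=
  clos_refl_sym_trans labels D3_relation.

(* Main.v *)
(** Each of the six twisted pairs of strands is antiparallel, so the skein
  relation at one of its crossings gives
  [nabla(2k half twists) = nabla(no twist) + k z nabla(smoothed pair)].  Hence
  [nabla] of [K] is a sum over the 64 ways of smoothing or untwisting the six
  pairs; each resulting crossingless diagram contributes 1 if it is a single
  circle and 0 otherwise.  In terms of the halved labels, this gives
  [1 + (a(p+q) + b(q+r) + c(r+p)) z^2 + (pq+qr+rp)(ab+bc+ca) z^4].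
  Only the coefficient of [z^2] can distinguish [(a,b,c)] from [tau(a,b,c)];
  for [(b,a,c)], for instance, the two coefficients differ by [(a-b)(p-r)], and
  if [p = r] the two arrays are exchanged by a reflection. *)
Require Import Defs.
From Stdlib Require Import Relation_Operators.
From mathcomp Require Import all_boot all_order all_algebra.
From mathcomp Require Import zify ring.
Set Implicit Arguments.
Unset Strict Implicit.
Unset Printing Implicit Defensive.
Import GRing.Theory Num.Theory.
Local Open Scope ring_scope.

Local Arguments run : simpl never.
Local Arguments up : simpl never.

(** * Orientation lists along a diagram *)

Lemma run_cat s D1 D2 : run s (D1 ++ D2) = obind (run^~ D2) (run s D1).
Proof.
rewrite /run foldl_cat; case: (foldl _ _ D1) => //=.
by elim: D2.
Qed.

Lemma run_cons s x D : run s (x :: D) = obind (run^~ D) (up s x).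
Proof. by rewrite -cat1s run_cat. Qed.

Lemma link_cat D1 D2 s :
  run [::] D1 = Some s -> link_diagram (D1 ++ D2) = (run s D2 == Some [::]).
Proof. by rewrite /link_diagram run_cat => ->. Qed.

Lemma link_run D1 D2 : link_diagram (D1 ++ D2) -> exists s, run [::] D1 = Some s.
Proof. by rewrite /link_diagram run_cat; case: run => // s _; exists s. Qed.

Lemma run_cup s t d D :
  run (s ++ t) ((Cup d, size s) :: D) = run (s ++ [:: d, ~~ d & t]) D.
Proof. by rewrite run_cons /up size_cat leq_addr take_size_cat ?drop_size_cat. Qed.

Lemma run_cap s t u D :
  run (s ++ [:: u, ~~ u & t]) ((Cap, size s) :: D) = run (s ++ t) D.
Proof.
by rewrite run_cons /up drop_size_cat // take_size_cat //; case: u.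
Qed.

Lemma run_capN s t u D :
  run (s ++ [:: ~~ u, u & t]) ((Cap, size s) :: D) = run (s ++ t) D.
Proof. by have := run_cap s t (~~ u) D; rewrite negbK. Qed.

Lemma run_cross s t u v b D :
  run (s ++ [:: u, v & t]) ((Cross b, size s) :: D) = run (s ++ [:: v, u & t]) D.
Proof. by rewrite run_cons /up drop_size_cat ?take_size_cat. Qed.

Lemma run_cupS s t u d D :
  run (s ++ u :: t) ((Cup d, (size s).+1) :: D) = run (s ++ [:: u, d, ~~ d & t]) D.
Proof. by have := @run_cup (rcons s u) t d D; rewrite !cat_rcons size_rcons. Qed.

Lemma run_capS s t u v D :
  run (s ++ [:: u, v, ~~ v & t]) ((Cap, (size s).+1) :: D) = run (s ++ u :: t) D.
Proof. by have := @run_cap (rcons s u) t v D; rewrite !cat_rcons size_rcons. Qed.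

Lemma run_capNS s t u v D :
  run (s ++ [:: u, ~~ v, v & t]) ((Cap, (size s).+1) :: D) = run (s ++ u :: t) D.
Proof. by have := run_capS s t u (~~ v) D; rewrite negbK. Qed.

Lemma run_crossS s t u v w b D :
  run (s ++ [:: u, v, w & t]) ((Cross b, (size s).+1) :: D)
    = run (s ++ [:: u, w, v & t]) D.
Proof. by have := @run_cross (rcons s u) t v w b D; rewrite !cat_rcons size_rcons. Qed.

Lemma run_twist s i b n D : (i.+1 < size s)%N ->
  run s (nseq n.*2 (Cross b, i) ++ D) = run s D.
Proof.
move=> lt_is; elim: n => //= n IHn; rewrite -[LHS]/(run s [:: _, _ & _]).
have i_s : size (take i s) = i by rewrite size_takel //; lia.
case sE: (drop i s) => [|u [|v t]]; try by have := size_drop i s; rewrite sE /=; lia.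
by rewrite -[s](cat_take_drop i) sE -{2 3}i_s !run_cross -sE cat_take_drop.
Qed.

(** Each crossing directly above a minimum exchanges two opposite orientations, so only the parity
    of [n] matters. *)
Lemma run_kinks s t d b n D :
  run (s ++ t) ((Cup d, size s) :: nseq n (Cross b, size s) ++ D)
    = run (s ++ t) ((Cup (odd n (+) d), size s) :: D).
Proof.
elim: n d => //= n IHn d; rewrite addNb -addbN -IHn.
by rewrite !run_cup run_cross negbK.
Qed.

(** * Skein relation for twisted pairs and for split circles *)

Section ConwayPolynomial.

Variables (nabla : odiagram -> {poly int}) (nablaP : is_conway_polynomial nabla).

Lemma nabla_local_move E E' D1 D2 :
    local_move E E' -> link_diagram (D1 ++ E ++ D2) ->
  link_diagram (D1 ++ E' ++ D2) -> nabla (D1 ++ E ++ D2) = nabla (D1 ++ E' ++ D2).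
Proof.
move=> EE' lE lE'; apply: (conway_isotopy nablaP).
by apply: rst_step; apply: Move EE' lE lE'.
Qed.

(** The crossings are curls, removed one by one by Reidemeister 1; each removal reverses the
    orientation recorded at the minimum. *)
Lemma nabla_kinks s t d b n D1 D2 :
    run [::] D1 = Some (s ++ t) ->
    link_diagram (D1 ++ (Cup d, size s) :: nseq n (Cross b, size s) ++ D2) ->
  nabla (D1 ++ (Cup d, size s) :: nseq n (Cross b, size s) ++ D2)
    = nabla (D1 ++ (Cup (odd n (+) d), size s) :: D2).
Proof.
move=> D1E; elim: n d => //= n IHn d lD.
have lD' : link_diagram (D1 ++ (Cup (~~ d), size s)
                          :: nseq n (Cross b, size s) ++ D2).
  move: lD; rewrite !(link_cat _ D1E).
  by rewrite (run_kinks s t d b n.+1) run_kinks /= addNb addbN.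
rewrite addNb -addbN -IHn //.
exact: (nabla_local_move (Reidemeister1Cup d b (size s))) lD lD'.
Qed.

(** Induction on the full twists: crossings of antiparallel strands with sign [true] are positive.
    Switching the lowest one cancels it against the next by Reidemeister 2. Smoothing it leaves an
    odd number of curls on a new minimum, which turn [Cup (~~ u)] into [Cup u]. *)
Lemma nabla_twist s t u k D1 D2 :
    run [::] D1 = Some (s ++ [:: u, ~~ u & t]) -> link_diagram (D1 ++ D2) ->
  nabla (D1 ++ nseq k.*2 (Cross true, size s) ++ D2)
    = nabla (D1 ++ D2)
      + k%:R * 'X * nabla (D1 ++ [:: (Cap, size s); (Cup u, size s)] ++ D2).
Proof.
move=> D1E lD; elim: k => [|k IHk]; first by rewrite !mul0r addr0.
pose T := nseq k.*2 (Cross true : piece bool, size s) ++ D2.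
have lT : link_diagram (D1 ++ T).
  by move: lD; rewrite !(link_cat _ D1E) run_twist // size_cat /=; lia.
have lC c c' : link_diagram (D1 ++ (Cross c, size s) :: (Cross c', size s) :: T).
  by move: lT; rewrite !(link_cat _ D1E) !run_cross.
have D1CE : run [::] (D1 ++ [:: (Cap, size s)]) = Some (s ++ t).
  by rewrite run_cat D1E [obind _ _]run_cap.
have smE : smoothing u (~~ u) (size s) = [:: (Cap, size s); (Cup (~~ u), size s)].
  by case: (u).
have lS : link_diagram (D1 ++ smoothing u (~~ u) (size s)
                         ++ (Cross true, size s) :: T).
  move: (lC true true); rewrite !(link_cat _ D1E) smE.
  by rewrite run_cap run_cup negbK !run_cross.
have := conway_skein nablaP D1E (D2 := (Cross true, size s) :: T).
rewrite /positive_crossing /negative_crossing.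
have [-> ->] : (u != ~~ u) /\ (u == ~~ u) = false by case: (u).
move=> /(_ (lC _ _) (lC _ _) lS) /eqP; rewrite subr_eq => /eqP ->.
rewrite (nabla_local_move (E := [:: (Cross false, size s); (Cross true, size s)])
  (E' := [::]) (D2 := T) (Reidemeister2 false _) (lC _ _) lT) [X in _ + X]IHk.
have -> : nabla (D1 ++ smoothing u (~~ u) (size s) ++ (Cross true, size s) :: T)
          = nabla (D1 ++ [:: (Cap, size s); (Cup u, size s)] ++ D2).
  move: lS; rewrite smE.
  have := @nabla_kinks s t (~~ u) true k.*2.+1 (D1 ++ [:: (Cap, size s)]) D2 D1CE.
  by rewrite -!catA /= odd_double /= negbK.
by rewrite addrCA -[k.+1]addn1 natrD; ring.
Qed.

(** A crossing inserted in the circle is a curl that can be removed at the maximum, which keeps [d],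
    or at the minimum, which reverses it. *)
Lemma nabla_circle_flip s t d D1 D2 :
    run [::] D1 = Some (s ++ t) ->
    link_diagram (D1 ++ (Cup d, size s) :: (Cap, size s) :: D2) ->
  nabla (D1 ++ (Cup (~~ d), size s) :: (Cap, size s) :: D2)
    = nabla (D1 ++ (Cup d, size s) :: (Cap, size s) :: D2).
Proof.
move=> D1E lD.
have lC : link_diagram
    (D1 ++ [:: (Cup d, size s), (Cross true, size s), (Cap, size s) & D2]).
  by move: lD; rewrite !(link_cat _ D1E) !run_cup run_cross run_cap run_capN.
have D1cE : run [::] (D1 ++ [:: (Cup d, size s)]) = Some (s ++ [:: d, ~~ d & t]).
  by rewrite run_cat D1E [obind _ _]run_cup.
have := @nabla_kinks s t d true 1 D1 ((Cap, size s) :: D2) D1E lC; rewrite /= => <-.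
have := @nabla_local_move _ _ (D1 ++ [:: (Cup d, size s)]) D2
  (Reidemeister1Cap true (size s)).
by rewrite -!catA; apply.
Qed.

(* The circle is the oriented smoothing of a crossing with the neighbouring
  strand; both resolutions of that crossing are curls on the strand. *)
Lemma nabla_circle_right s t u d D1 D2 :
    run [::] D1 = Some (s ++ u :: t) ->
    link_diagram (D1 ++ (Cup d, size s) :: (Cap, size s) :: D2) ->
  nabla (D1 ++ (Cup d, size s) :: (Cap, size s) :: D2) = 0.
Proof.
move=> D1E lD.
(* With this orientation the right side of the circle is parallel to the neighbouring strand, so
   smoothing a crossing between them merely deletes it. *)
wlog dE : d lD / d = ~~ u.
  move=> IH; case: (eqVneq d (~~ u)) => [|du]; first exact: IH.
  have lD' : link_diagram (D1 ++ (Cup (~~ u), size s) :: (Cap, size s) :: D2).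
    by move: lD; rewrite !(link_cat _ D1E) !run_cup !run_cap.
  rewrite -(IH _ lD') // -(nabla_circle_flip D1E lD').
  by case: d u du {IH lD lD' D1E} => -[].
rewrite {}dE in lD *.
have lD12 : link_diagram (D1 ++ D2).
  by move: lD; rewrite !(link_cat _ D1E) run_cup run_cap.
pose C c :=
  D1 ++ [:: (Cup (~~ u), size s), (Cross c, (size s).+1), (Cap, size s) & D2].
have lC c : link_diagram (C c).
  by move: lD12; rewrite !(link_cat _ D1E) run_cup negbK run_crossS run_capN.
(* Sliding the minimum past the neighbouring strand moves the crossing under the maximum;
   Reidemeister 1 and a zigzag then straighten the strand. *)
have curl c : nabla (C c) = nabla (D1 ++ D2).
  have lS : link_diagram (D1 ++ [:: (Cup (~~ u), (size s).+1),
                                    (Cross (~~ c), size s), (Cap, size s) & D2]).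
    by move: lD12; rewrite !(link_cat _ D1E) run_cupS negbK run_cross run_capN.
  have lZ : link_diagram
      (D1 ++ [:: (Cup (~~ u), (size s).+1), (Cap, size s) & D2]).
    by move: lD12; rewrite !(link_cat _ D1E) run_cupS negbK run_cap.
  rewrite (nabla_local_move (SlideCup (~~ u) c (size s)) (lC c) lS).
  rewrite -(nabla_local_move (ZigzagL (~~ u) (size s)) lZ lD12).
  have := @nabla_local_move _ _ (D1 ++ [:: (Cup (~~ u), (size s).+1)])
    D2 (Reidemeister1Cap (~~ c) (size s)).
  by rewrite -!catA; apply.
have := conway_skein nablaP (D1 := D1 ++ [:: (Cup (~~ u), size s)])
  (s := s ++ [:: ~~ u]) (u := u) (v := u) (t := t).
rewrite run_cat D1E [obind _ _]run_cup negbK size_cat addn1 -catA.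
move=> /(_ ((Cap, size s) :: D2)).
rewrite /smoothing /positive_crossing /negative_crossing eqxx -!catA /=.
move=> /(_ erefl (lC _) (lC _) lD).
rewrite [nabla _]curl [X in _ - X]curl subrr => /esym/eqP.
by rewrite mulf_eq0 polyX_eq0 => /eqP.
Qed.

(** Mirror image of [nabla_circle_right]: the neighbouring strand is now on the left, and it is the
    left side of the circle that is made parallel to it. *)
Lemma nabla_circle_left s t u d D1 D2 :
    run [::] D1 = Some (s ++ u :: t) ->
    link_diagram (D1 ++ (Cup d, (size s).+1) :: (Cap, (size s).+1) :: D2) ->
  nabla (D1 ++ (Cup d, (size s).+1) :: (Cap, (size s).+1) :: D2) = 0.
Proof.
move=> D1E lD.
wlog dE : d lD / d = u.
  move=> IH; case: (eqVneq d u) => [|du]; first exact: IH.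
  have lD' : link_diagram (D1 ++ (Cup u, (size s).+1) :: (Cap, (size s).+1) :: D2).
    by move: lD; rewrite !(link_cat _ D1E) !run_cupS !run_capS.
  have := @nabla_circle_flip (rcons s u) t u D1 D2.
  rewrite cat_rcons size_rcons (IH u lD' erefl) => /(_ D1E lD') <-.
  by case: d u du {IH lD lD' D1E} => -[].
rewrite {}dE in lD *.
have lD12 : link_diagram (D1 ++ D2).
  by move: lD; rewrite !(link_cat _ D1E) run_cupS run_capS.
pose C c :=
  D1 ++ [:: (Cup u, (size s).+1), (Cross c, size s), (Cap, (size s).+1) & D2].
have lC c : link_diagram (C c).
  by move: lD12; rewrite !(link_cat _ D1E) run_cupS run_cross run_capS.
have curl c : nabla (C c) = nabla (D1 ++ D2).
  have lS : link_diagram (D1 ++ [:: (Cup u, size s), (Cross (~~ c), (size s).+1),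
                                    (Cap, (size s).+1) & D2]).
    by move: lD12; rewrite !(link_cat _ D1E) run_cup run_crossS run_capS.
  have lZ : link_diagram (D1 ++ [:: (Cup u, size s), (Cap, (size s).+1) & D2]).
    by move: lD12; rewrite !(link_cat _ D1E) run_cup run_capNS.
  have := nabla_local_move (SlideCup u (~~ c) (size s)) lS.
  rewrite negbK => /(_ (lC c)) <-.
  rewrite -(nabla_local_move (ZigzagR u (size s)) lZ lD12).
  have := @nabla_local_move _ _ (D1 ++ [:: (Cup u, size s)]) D2
    (Reidemeister1Cap (~~ c) (size s).+1).
  by rewrite -!catA; apply.
have := conway_skein nablaP (D1 := D1 ++ [:: (Cup u, (size s).+1)])
  (s := s) (u := u) (v := u) (t := ~~ u :: t).
rewrite run_cat D1E [obind _ _]run_cupS.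
move=> /(_ ((Cap, (size s).+1) :: D2)).
rewrite /smoothing /positive_crossing /negative_crossing eqxx -!catA /=.
move=> /(_ erefl (lC _) (lC _) lD).
rewrite [nabla _]curl [X in _ - X]curl subrr => /esym/eqP.
by rewrite mulf_eq0 polyX_eq0 => /eqP.
Qed.

(** * Evaluation of crossingless diagrams *)

Lemma up_nil x t : up [::] x = Some t -> exists d, x = (Cup d, 0%N).
Proof. by rewrite /up; case: x => -[d||b] [|i] // _; exists d. Qed.

Lemma up_to_nil s x : up s x = Some [::] -> x = (Cap, 0%N) /\ exists u, s = [:: u; ~~ u].
Proof.
case: x => -[d|/=|b] i; rewrite /up.
- by case: ifP => // _ []; case: take.
- case dE: (drop i s) => [|u [|v t]] //; case: ifP => // uv [].
  case: i dE => [|i]; last by case: s.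
  by rewrite drop0 take0 /= => -> ->; split=> //; exists u; case: u v uv => -[].
- by case: drop => [|u [|v t]] //; case: take.
Qed.

(** A strand at the level of the circle makes it split off, with value 0. If there is none but the
    diagram has other slices, exchanges bring the circle to a level with a strand. *)
Lemma nabla_circle d i D1 D2 :
    link_diagram (D1 ++ (Cup d, i) :: (Cap, i) :: D2) ->
  nabla (D1 ++ (Cup d, i) :: (Cap, i) :: D2) = (nilp D1 && nilp D2)%:R.
Proof.
move=> lD; have [s D1E] := link_run lD.
have le_i : (i <= size s)%N.
  by move: lD; rewrite (link_cat _ D1E) run_cons /up; case: ifP.
have [s0|s_gt0] := posnP (size s); last first.
  have -> : nilp D1 = false by case: D1 D1E {lD} => // -[sE]; rewrite -sE in s_gt0.
  case: i le_i lD => [_|i lt_i] lD.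
    case: s D1E s_gt0 => // u t D1E _.
    exact: (nabla_circle_right (s := [::]) D1E).
  rewrite -(cat_take_drop i s) (drop_nth true) // in D1E.
  have := nabla_circle_left D1E; rewrite size_takel 1?ltnW // => /(_ d D2 lD).
  exact.
move/size0nil: s0 => sE; move: le_i; rewrite sE leqn0 => /eqP iE.
rewrite {s}sE {i}iE in D1E lD *.
(* The slice above the circle can only be a minimum; two exchanges lift the circle above it, to the
   left of its strands. *)
case: D2 lD => [|x D2] lD; last first.
  have [d' xE] : exists d', x = (Cup d', 0%N).
    move: lD; rewrite (link_cat _ D1E) (run_cup [::] [::]) (run_cap [::] [::]) run_cons.
    by case xE: up => [t|] // _; apply: up_nil xE.
  rewrite [_ && _]andbF {x}xE in lD *.
  have lN : link_diagram
      ((D1 ++ [:: (Cup d', 0%N)]) ++ (Cup d, 0%N) :: (Cap, 0%N) :: D2).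
    by move: lD; rewrite -catA !(link_cat _ D1E); case: (d) (d') => -[].
  have lM : link_diagram (D1 ++ [:: (Cup d, 0%N), (Cup d', 2%N), (Cap, 0%N) & D2]).
    by move: lD; rewrite !(link_cat _ D1E); case: (d) (d') => -[].
  have D1dE : run [::] (D1 ++ [:: (Cup d', 0%N)]) = Some [:: d'; ~~ d'].
    by rewrite run_cat D1E.
  rewrite -[RHS](nabla_circle_right (s := [::]) D1dE lN).
  rewrite -catA in lN *.
  rewrite -(nabla_local_move (D2 := (Cap, 0%N) :: D2)
    (Exchange (Cup d) (Cup d') 0 0) lM lN).
  have := @nabla_local_move _ _ (D1 ++ [:: (Cup d, 0%N)]) D2
    (Exchange Cap (Cup d') 0 0).
  by rewrite -!catA; apply.
(* Nothing lies above the circle. A slice just below it must be a maximum, and the circle is lowered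
   to the right of the strands that this maximum joins. *)
case: (lastP D1) D1E lD => [|{}D1 x] D1E lD.
  by rewrite (conway_unknot nablaP).
have -> : nilp (rcons D1 x) = false by case: (D1).
move: D1E; rewrite -cats1 run_cat; case D1E: run => [s|] //=.
rewrite run_cons; case xE: up => [s'|] //= [s'E].
move: xE; rewrite s'E => /up_to_nil [xE [u sE]]; rewrite {}xE {}sE in lD D1E *.
rewrite -cats1 -!catA /= in lD *.
have lM : link_diagram (D1 ++ [:: (Cup d, 2%N); (Cap, 0%N); (Cap, 0%N)]).
  by rewrite (link_cat _ D1E); case: (u) (d) => -[].
have lN : link_diagram (D1 ++ [:: (Cup d, 2%N); (Cap, 2%N); (Cap, 0%N)]).
  by rewrite (link_cat _ D1E); case: (u) (d) => -[].
rewrite -[RHS](nabla_circle_left (s := [:: u]) D1E lN).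
rewrite (nabla_local_move (D2 := [:: (Cap, 0%N)]) (Exchange Cap (Cup d) 0 0) lD lM).
have := @nabla_local_move _ _ (D1 ++ [:: (Cup d, 2%N)]) [::] (Exchange Cap Cap 0 0).
by rewrite -!catA => ->.
Qed.

(* The diagram is [rev D1 ++ D2]; the first maximum of [D2] is pushed down
  through the minima of [D1] until it cancels one of them or closes up a
  circle with it. *)
Fixpoint is_unknot (fuel : nat) (D1 D2 : odiagram) : option bool :=
  if fuel is fuel'.+1 then
    if ~~ link_diagram (catrev D1 D2) then None else
    match D2, D1 with
    | (Cup d, i) :: D2', _ => is_unknot fuel' ((Cup d, i) :: D1) D2'
    | (Cap, i) :: D2', (Cup d, j) :: D1' =>
        if i == j then Some (nilp D1' && nilp D2')
        else if (i.+1 == j) || (j.+1 == i) then is_unknot fuel' D1' D2'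
        else if (j < i)%N then
          is_unknot fuel' D1' [:: (Cap, (i - 2)%N), (Cup d, j) & D2']
        else is_unknot fuel' D1' [:: (Cap, i), (Cup d, (j - 2)%N) & D2']
    | _, _ => None
    end
  else None.

Lemma is_unknot_link fuel D1 D2 b :
  is_unknot fuel D1 D2 = Some b -> link_diagram (rev D1 ++ D2).
Proof. by rewrite -catrevE; case: fuel => //= fuel; case: ifP => // /negbFE. Qed.

(** Each step of [is_unknot] regroups the slices, cancels a zigzag or exchanges two distant slices,
    all of which preserve [nabla]; [nabla_circle] evaluates the end result. *)
Lemma nabla_is_unknot fuel D1 D2 b :
  is_unknot fuel D1 D2 = Some b -> nabla (rev D1 ++ D2) = b%:R.
Proof.
elim: fuel D1 D2 => //= fuel IHf D1 D2; rewrite catrevE; case: ifP => // /negbFE.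
case: D2 => [|[[d||c] i] D2] //.
  by move=> _ /IHf <-; rewrite rev_cons cat_rcons.
case: D1 => [|[[d||c] j] D1] //; rewrite rev_cons cat_rcons => lD.
have [ij|ij] := eqVneq i j.
  move=> [<-]; rewrite ij in lD *; have := nabla_circle lD.
  by rewrite [nilp (rev _)]/nilp size_rev.
have step E E' : local_move E E' \/ local_move E' E ->
    [:: (Cup d, j), (Cap, i) & D2] = E ++ D2 ->
    is_unknot fuel D1 (E' ++ D2) = Some b ->
    nabla (rev D1 ++ [:: (Cup d, j), (Cap, i) & D2]) = b%:R.
  move=> EE' DE HE'; have lE' := is_unknot_link HE'.
  rewrite -(IHf _ _ HE') DE in lD *.
  by case: EE' => EE'; [|symmetry]; apply: (nabla_local_move EE').
case: ifP => [/orP[] /eqP ji|nji].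
- by apply: step (or_introl (ZigzagL d i)) _; rewrite ji.
- by apply: step (or_introl (ZigzagR d j)) _; rewrite ji.
case: ifP => [lt_ji|nlt_ji].
(* The excluded cases leave [j.+2 <= i], so the truncated subtractions are exact. *)
- have := step _ _ (or_introl (Exchange (Cup d) Cap j (i - j.+2))).
  have -> : (j + strands_above (Cup d) + (i - j.+2) = i)%N by rewrite /=; lia.
  have -> : (j + strands_below (Cup d) + (i - j.+2) = i - 2)%N by rewrite /=; lia.
  exact.
- have := step _ _ (or_intror (Exchange Cap (Cup d) i (j - i.+2))).
  have -> : (i + @strands_above bool Cap + (j - i.+2) = j - 2)%N by rewrite /=; lia.
  have -> : (i + @strands_below bool Cap + (j - i.+2) = j)%N by rewrite /=; lia.
  exact.
Qed.

(** * State sums for diagrams with twisted holes *)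

Local Arguments is_unknot : simpl never.

(* A template is a diagram with holes; the hole [(i, j)] is a pair of
  antiparallel strands, with [i] strands to its left, twisted by the [j]-th
  number of full twists. *)
Definition template : Type := seq (slice bool + nat * nat).

Definition fill (k : nat -> nat) (x : slice bool + nat * nat) : odiagram :=
  match x with
  | inl y => [:: y]
  | inr (i, j) => nseq (k j).*2 (Cross true, i)
  end.

(* The sets of holes whose smoothing, together with the untwisting of the other
  holes, produces an unknot. *)
Fixpoint unknot_states (D : odiagram) (T : template) : option (seq (seq nat)) :=
  match T with
  | [::] => omap (fun b : bool => nseq b [::]) (is_unknot (size D).*2.+1 [::] D)
  | inl x :: T' => unknot_states (rcons D x) T'
  | inr (i, j) :: T' =>
      if run [::] D is Some s then
        if drop i s is u :: v :: _ then
          if u != v then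
            if (unknot_states D T',
                unknot_states (D ++ [:: (Cap, i); (Cup u, i)]) T')
              is (Some M0, Some M1) then Some (M0 ++ map (cons j) M1) else None
          else None
        else None
      else None
  end.

(** Each hole is expanded by [nabla_twist]: untwisting it has weight 1, smoothing it has weight
    [(k j)%:R * 'X]. *)
Lemma nabla_states k D T M : unknot_states D T = Some M ->
  link_diagram (D ++ flatten (map (fill k) T)) /\
  nabla (D ++ flatten (map (fill k) T))
    = \sum_(m <- M) \prod_(j <- m) ((k j)%:R * 'X).
Proof.
elim: T D M => [|[x|[i j]] T IHT] D M.
- rewrite [unknot_states _ _]/= cats0; case bE: is_unknot => [b|] //= [<-].
  rewrite (nabla_is_unknot bE) (is_unknot_link bE); split=> //.
  by case: b {bE}; rewrite ?big_seq1 big_nil.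
- by move=> /IHT; rewrite cat_rcons.
rewrite [unknot_states _ _]/=; case DE: run => [s|] //.
case sE: (drop i s) => [|u [|v t]] //; case: ifP => // uv.
case E0: unknot_states => [M0|] //; case E1: unknot_states => [M1|] //= [<-].
have vE : v = ~~ u by case: u v uv {sE E1} => -[].
have iE : i = size (take i s).
  rewrite size_takel // leqNgt; apply/negP => /ltnW /drop_oversize.
  by rewrite sE.
have {sE vE} DE : run [::] D = Some (take i s ++ [:: u, ~~ u & t]).
  by rewrite -vE -sE cat_take_drop.
have [l0 n0] := IHT _ _ E0; have [_ n1] := IHT _ _ E1.
split.
  move: l0; rewrite !(link_cat _ DE) /= run_twist // size_cat /= -iE; lia.
have := nabla_twist (k j) DE l0; rewrite -iE /= => ->.
rewrite n0 big_cat big_map -catA in n1 *; rewrite n1 big_distrr.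
by congr (_ + _); apply: eq_bigr => m _; rewrite big_cons.
Qed.

End ConwayPolynomial.

(** * The Conway polynomial of [K] *)

(** Holes 0 to 5 carry the halves of p, q, r, a, b, c. The outer minimum is opposite to the other
    two, so that orientations alternate along the circle C and all six pairs are antiparallel. *)
Definition oriented_K (d : bool) : template :=
  [:: inl (Cup (~~ d), 0); inl (Cup d, 1); inl (Cup d, 3);
      inr (0, 0); inr (2, 1); inr (4, 2); inr (1, 3); inr (3, 4);
      inl (Cap, 2); inr (1, 5); inl (Cap, 0); inl (Cap, 0)]%N.

Lemma erase_cup D i E : erase D = (Cup tt, i) :: E ->
  exists d D', D = (Cup d, i) :: D' /\ erase D' = E.
Proof. by case: D => [|[[d||c] j] D] // [-> <-]; exists d, D. Qed.

(** Only minima carry orientations, so nothing is lost by erasing them elsewhere. *)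
Lemma erase_cupless (E : diagram) D :
    all (fun x : slice unit => if x.1 is Cup _ then false else true) E ->
    erase D = E ->
  D = map (fun x => (if x.1 is Cross c then Cross c else Cap, x.2)) E.
Proof.
move=> + DE; rewrite -{E}DE.
by elim: D => [|[[d||c] i] D IHD] //= /IHD DE; congr (_ :: _).
Qed.

Lemma oriented_KP (p q r a b c : nat) D :
    let k := nth 0%N [:: p; q; r; a; b; c] in
    orientation_of (K ((p.*2 : int, q.*2 : int, r.*2 : int),
                       (a.*2 : int, b.*2 : int, c.*2 : int))) D ->
  exists d, D = flatten (map (fill k) (oriented_K d)).
Proof.
move=> k [lD]; rewrite /K /twist /=.
move=> /erase_cup[d1 [D1 [DE /erase_cup[d2 [D2 [DE1
  /erase_cup[d3 [D3 [DE2 DE3]]]]]]]]].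
move: lD; rewrite {}DE {}DE1 {}DE2 (erase_cupless _ DE3); last first.
  by do 2!rewrite ?(all_cat, all_nseq) /= ?orbT.
do 2!rewrite ?(map_cat, map_nseq) /=; rewrite /link_diagram.
(* Of the eight choices, the maxima allow only the two with [d2 = d3 = ~~ d1]. *)
move: d1 d2 d3 => [] [] [].
all: do 9!rewrite ?(run_twist, run_cons) // /up /=.
  by move=> _; exists false.
by move=> _; exists true.
Qed.

(** Sixteen of the 64 states are a single circle: 1, 6 and 9 of them smooth 0, 2 and 4 holes, one
    for each monomial of the polynomial. They are the same for both orientations. *)
Lemma unknot_states_K d : unknot_states [::] (oriented_K d) =
  Some [:: [::]; [:: 2; 5]; [:: 2; 4]; [:: 1; 4]; [:: 1; 3];
    [:: 1; 2; 4; 5]; [:: 1; 2; 3; 5]; [:: 1; 2; 3; 4]; [:: 0; 5]; [:: 0; 3];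
    [:: 0; 2; 4; 5]; [:: 0; 2; 3; 5]; [:: 0; 2; 3; 4]; [:: 0; 1; 4; 5];
    [:: 0; 1; 3; 5]; [:: 0; 1; 3; 4]]%N.
Proof. by case: d; vm_compute. Qed.

Lemma nabla_K nabla (p q r a b c : nat) D : is_conway_polynomial nabla ->
    orientation_of (K ((p.*2 : int, q.*2 : int, r.*2 : int),
                       (a.*2 : int, b.*2 : int, c.*2 : int))) D ->
  nabla D = 1 + (a * (p + q) + b * (q + r) + c * (r + p))%:R * 'X^2
              + ((p * q + q * r + r * p) * (a * b + b * c + c * a))%:R * 'X^4.
Proof.
move=> nablaP /oriented_KP[d ->].
rewrite (nabla_states nablaP _ (unknot_states_K d)).2.
rewrite !(big_cons, big_nil) /= !(natrD, natrM); ring.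
Qed.

Lemma conway_form_inj (m m' n n' : nat) : n = n' ->
  1 + m%:R * 'X^2 + n%:R * 'X^4 = 1 + m'%:R * 'X^2 + n'%:R * 'X^4 :> {poly int}
    <-> m = m'.
Proof.
move=> ->; split=> [/addIr/addrI|-> //].
move/(congr1 (fun f : {poly int} => f`_2)).
by rewrite !coefMXn !coefMn !coef1 /=; lia.
Qed.

(** * The coefficient of z^2 and the D_3 symmetries *)

Definition z2_coefficient (l : labels) : int :=
  let: ((p, q, r), (a, b, c)) := l in a * (p + q) + b * (q + r) + c * (r + p).

Lemma D3_z2_coefficient l l' :
  D3_symmetric l l' -> z2_coefficient l = z2_coefficient l'.
Proof.
elim=> // [_ _ [] * /=|_ _ _ _ -> //]; first [ring | by move->].
Qed.

(** The difference of the two values is a product of a difference of two lower labels and one of two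
    upper labels. Equal lower labels make the arrays identical; equal upper labels let a reflection,
    followed by a rotation if necessary, exchange the arrays. *)
Lemma D3_swap p q r a b c abc' :
    [\/ abc' = (b, a, c), abc' = (a, c, b) | abc' = (c, b, a)] ->
    z2_coefficient ((p, q, r), (a, b, c)) = z2_coefficient ((p, q, r), abc') ->
  D3_symmetric ((p, q, r), (a, b, c)) ((p, q, r), abc').
Proof.
have R l l' : D3_relation l l' -> D3_symmetric l l' by apply: rst_step.
have T := @rst_trans _ D3_relation.
have factor (x y u v : int) : (x - y) * (u - v) = 0 -> x = y \/ u = v.
  by move=> /eqP; rewrite mulf_eq0 !subr_eq0 => /orP[] /eqP; [left | right].
case=> -> /= /eqP; rewrite -subr_eq0 => /eqP eq0.
- case: (factor a b p r) => [|->|->]; first by rewrite -[RHS]eq0; ring.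
    exact: rst_refl.
  exact: T _ _ _ (R _ _ (Reflection _ _ _ _ _ _)) (R _ _ (Rotation1 _ _ _ _ _ _)).
- case: (factor b c q p) => [|->|->]; first by rewrite -[RHS]eq0; ring.
    exact: rst_refl.
  exact: T _ _ _ (R _ _ (Reflection _ _ _ _ _ _)) (R _ _ (Rotation2 _ _ _ _ _ _)).
- case: (factor a c q r) => [|->|->]; first by rewrite -[RHS]eq0; ring.
    exact: rst_refl.
  exact: R _ _ (Reflection _ _ _ _ _ _).
Qed.

Lemma even_pos_double (n : int) : 0 < n -> (2 %| n)%Z -> exists m : nat, n = m.*2.
Proof. by case: n => // n _ /dvdnP[m /= ->]; exists m; rewrite muln2. Qed.

Theorem lemma4p3 (nabla : odiagram -> {poly int})
    (nablaP : is_conway_polynomial nabla)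
    (p q r a b c : int) (abc' : int * int * int)
    (pos : [/\ 0 < p, 0 < q & 0 < r] /\ [/\ 0 < a, 0 < b & 0 < c])
    (even : [/\ (2 %| p)%Z, (2 %| q)%Z & (2 %| r)%Z] /\
            [/\ (2 %| a)%Z, (2 %| b)%Z & (2 %| c)%Z])
    (tau : [\/ abc' = (b, a, c), abc' = (a, c, b) | abc' = (c, b, a)])
    (D D' : odiagram)
    (DK : orientation_of (K ((p, q, r), (a, b, c))) D)
    (DK' : orientation_of (K ((p, q, r), abc')) D') :
  nabla D = nabla D' <->
  D3_symmetric ((p, q, r), (a, b, c)) ((p, q, r), abc').
Proof.
have [[/even_pos_double pE /even_pos_double qE /even_pos_double rE]
  [/even_pos_double aE /even_pos_double bE /even_pos_double cE]] := pos.
have [[/pE[p' {}pE] /qE[q' {}qE] /rE[r' {}rE]]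
  [/aE[a' {}aE] /bE[b' {}bE] /cE[c' {}cE]]] := even.
suff -> : nabla D = nabla D' <->
    z2_coefficient ((p, q, r), (a, b, c)) = z2_coefficient ((p, q, r), abc').
  split; first exact: D3_swap.
  exact: D3_z2_coefficient.
subst p q r a b c; rewrite (nabla_K nablaP DK).
case: tau DK' => -> DK'; rewrite (nabla_K nablaP DK') /=.
(* The coefficient of z^4 is symmetric in the lower labels. *)
all: rewrite conway_form_inj; last by ring.
(* [z2_coefficient] takes the full labels, hence is four times the coefficient of z^2 in terms of
   their halves. *)
all: by split; lia.
Qed.
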